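(* Let $(\mathscr{C},\mathbb{E},\mathfrak{s})$ be a weakly idempotent complete extriangulated category with proper classes $\xi_1\subseteq\xi_2$ of $\mathbb{E}$-triangles, and for $i=1,2$ let $\mathcal{M}_i=(\mathcal{C}_i,\mathcal{W}_i,\mathcal{F}_i)$ be an admissible model structure relative to $\xi_i$, with $\mathcal{W}_1\subseteq\mathcal{W}_2$ and $\mathcal{F}_1\subseteq\mathcal{F}_2$. Let $\mathcal{C}_m={}^{\perp_1}(\mathcal{W}_2\cap\mathcal{F}_1)$ and let $\mathcal{M}_m=(\mathcal{C}_m,\mathcal{W}_2,\mathcal{F}_1)$ be the mixed model structure, an admissible model structure relative to $\xi_1$. Then an object $C$ belongs to $\mathcal{C}_m$ if and only if $C\in\mathcal{C}_1$ and there exists a $1$-weak equivalence $C_2\to C$ for some $C_2\in\mathcal{C}_2$. Moreover, for every $C\in\mathcal{C}_m$, there exists a $\xi_2$-deflation $p:C_2\to C$ with $C_2\in\mathcal{C}_2$ which is a $1$-weak equivalence.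
   Context: Extriangulated category (Nakaoka–Palu): a triple $(\mathscr{C},\mathbb{E},\mathfrak{s})$ with $\mathscr{C}$ an additive category, $\mathbb{E}:\mathscr{C}^{op}\times\mathscr{C}\to Ab$ a biadditive functor (write $a_*\delta=\mathbb{E}(C,a)(\delta)$, $c^*\delta=\mathbb{E}(c,A)(\delta)$), and $\mathfrak{s}$ assigning to each $\delta\in\mathbb{E}(C,A)$ an equivalence class $\mathfrak{s}(\delta)=[A\xrightarrow{x}B\xrightarrow{y}C]$ (two sequences from $A$ to $C$ are equivalent if there is an isomorphism of middle terms compatible with $1_A,1_C$), such that: (realization) if $a_*\delta=c^*\delta'$ with $\mathfrak{s}(\delta)=[A\xrightarrow{x}B\xrightarrow{y}C]$, $\mathfrak{s}(\delta')=[A'\xrightarrow{x'}B'\xrightarrow{y'}C']$, there is $b:B\to B'$ with $bx=x'a$, $y'b=cy$; (additivity) $\mathfrak{s}(0)=[A\to A\oplus C\to C]$ (canonical maps) and $\mathfrak{s}(\delta\oplus\delta')=\mathfrak{s}(\delta)\oplus\mathfrak{s}(\delta')$; (ET3) if $\mathfrak{s}(\delta)=[A\xrightarrow{x}B\xrightarrow{y}C]$, $\mathfrak{s}(\delta')=[A'\xrightarrow{x'}B'\xrightarrow{y'}C']$ and $a:A\to A'$, $b:B\to B'$ satisfy $bx=x'a$, there is $c:C\to C'$ with $cy=y'b$ and $a_*\delta=c^*\delta'$; (ET4) if $\delta\in\mathbb{E}(D,A)$ is realized by $A\xrightarrow{f}B\xrightarrow{f'}D$ and $\delta'\in\mathbb{E}(F,B)$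 by $B\xrightarrow{g}C\xrightarrow{g'}F$, there are an object $E$, morphisms $h':C\to E$, $d:D\to E$, $e:E\to F$ and $\delta''\in\mathbb{E}(E,A)$ realized by $A\xrightarrow{gf}C\xrightarrow{h'}E$ with $h'g=df'$, $eh'=g'$, $\mathfrak{s}(f'_*\delta')=[D\xrightarrow{d}E\xrightarrow{e}F]$, $d^*\delta''=\delta$, $f_*\delta''=e^*\delta'$; and the duals (ET3)$^{op}$, (ET4)$^{op}$. If $\mathfrak{s}(\delta)=[A\xrightarrow{x}B\xrightarrow{y}C]$, then $A\xrightarrow{x}B\xrightarrow{y}C\overset{\delta}{\dashrightarrow}$ is an $\mathbb{E}$-triangle, $x$ an $\mathbb{E}$-inflation, $y$ an $\mathbb{E}$-deflation, $C=\mathrm{Cone}(x)$, $A=\mathrm{CoCone}(y)$. It is split if $\delta=0$. Weakly idempotent complete: every split monomorphism in $\mathscr{C}$ has a cokernel (equivalently: if $ki$ is an $\mathbb{E}$-inflation, so is $i$). Proper class: a class $\xi$ of $\mathbb{E}$-triangles, closed under isomorphisms, such that (1) $\xi$ is closed under finite coproducts and contains all split $\mathbb{E}$-triangles; (2) $\xi$ is closed under base change (if the $\mathbb{E}$-triangle of $\delta\in\mathbb{E}(C,A)$ is in $\xi$, so is any realizing $c^*\delta$, $c:C'\to C$) and cobase change (likewise for $a_*\delta$, $a:A\to A'$); (3) $\xi$ is saturated: for $\mathbb{E}$-triangles $A_i\xrightarrow{x_i}B_i\xrightarrow{y_i}C\overset{\delta_i}{\dashrightarrow}$, $i=1,2$,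 if the triangle of $\delta_2$ and the triangle $A_1\to M\to B_2\dashrightarrow$ realizing $y_2^*\delta_1$ are in $\xi$, then the triangle of $\delta_1$ is in $\xi$. Members of $\xi$ are $\xi$-triangles; their first and second morphisms are $\xi$-inflations and $\xi$-deflations. Model structure: three classes (CoFib, Fib, Weq) of morphisms (cofibrations, fibrations, weak equivalences) satisfying: two-out-of-three for Weq; each class closed under retracts; cofibrations lift against fibrations whenever one of the two is a weak equivalence; every morphism factors as $pi$ and as $qj$ with $i\in\mathrm{CoFib}\cap\mathrm{Weq}$, $p\in\mathrm{Fib}$, $j\in\mathrm{CoFib}$, $q\in\mathrm{Fib}\cap\mathrm{Weq}$. $X$ is cofibrant if $0\to X$ is a cofibration, fibrant if $X\to0$ is a fibration, trivial if $0\to X$ is a weak equivalence; $\mathcal{C},\mathcal{F},\mathcal{W}$ denote the classes of cofibrant, fibrant and trivial objects. Admissible relative to $\xi$: CoFib = $\xi$-inflations with cone in $\mathcal{C}$; Fib = $\xi$-deflations with cocone in $\mathcal{F}$; $\mathrm{CoFib}\cap\mathrm{Weq}$ = $\xi$-inflations with cone in $\mathcal{C}\cap\mathcal{W}$; $\mathrm{Fib}\cap\mathrm{Weq}$ = $\xi$-deflations with cocone in $\mathcal{F}\cap\mathcal{W}$. Such a model structure is denoted by the triple $(\mathcal{C},\mathcal{W},\mathcal{F})$ of its classes of cofibrant, trivial and fibrant objects (in this order). Notation: $\mathbb{E}_i(X,Y)\subseteq\mathbb{E}(X,Y)$ consists of the extensions realized by $\xi_i$-triangles; ${}^{\perp_1}\mathcal{X}$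 is the class of objects $Z$ with $\mathbb{E}_1(Z,X)=0$ for all $X\in\mathcal{X}$. A $1$-weak equivalence is a weak equivalence of $\mathcal{M}_1$. Under the stated hypotheses the admissible model structure $\mathcal{M}_m$ relative to $\xi_1$ exists. *)

(* Defs.v *)
From mathcomp Require Import all_boot ssralg.
From mathcomp Require Import classical_sets.

Set Implicit Arguments.
Unset Strict Implicit.
Unset Printing Implicit Defensive.

Import GRing.Theory.
Local Open Scope ring_scope.
Local Open Scope classical_set_scope.

(* Abelian groups are zmodTypes; the choice operator that a zmodType carries is
   no restriction, since every type has one classically. *)
Record additiveCat := AdditiveCat {
  Ob :> Type;
  Mor : Ob -> Ob -> zmodType;
  idm : forall A, Mor A A;
  mcomp : forall A B C, Mor B C -> Mor A B -> Mor A C;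
  mcompA : forall A B C D (h : Mor C D) (g : Mor B C) (f : Mor A B),
    mcomp h (mcomp g f) = mcomp (mcomp h g) f;
  mcomp1m : forall A B (f : Mor A B), mcomp (idm B) f = f;
  mcompm1 : forall A B (f : Mor A B), mcomp f (idm A) = f;
  mcompDl : forall A B C (g g' : Mor B C) (f : Mor A B),
    mcomp (g + g') f = mcomp g f + mcomp g' f;
  mcompDr : forall A B C (g : Mor B C) (f f' : Mor A B),
    mcomp g (f + f') = mcomp g f + mcomp g f';
  zeroOb : Ob;
  idm_zeroOb : idm zeroOb = 0;
  dsum : Ob -> Ob -> Ob;
  injl : forall A B, Mor A (dsum A B);
  injr : forall A B, Mor B (dsum A B);
  prjl : forall A B, Mor (dsum A B) A;
  prjr : forall A B, Mor (dsum A B) B;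
  prjl_injl : forall A B, mcomp (prjl A B) (injl A B) = idm A;
  prjr_injr : forall A B, mcomp (prjr A B) (injr A B) = idm B;
  prjl_injr : forall A B, mcomp (prjl A B) (injr A B) = 0;
  prjr_injl : forall A B, mcomp (prjr A B) (injl A B) = 0;
  dsum_id : forall A B,
    mcomp (injl A B) (prjl A B) + mcomp (injr A B) (prjr A B) = idm (dsum A B)
}.

Arguments zeroOb : clear implicits.

Notation "g \@ f" := (mcomp g f) (at level 40, left associativity).

Definition is_iso (K : additiveCat) (A B : K) (f : Mor A B) : Prop :=
  exists g : Mor B A, g \@ f = idm A /\ f \@ g = idm B.

Definition dsum_mor (K : additiveCat) (A B A' B' : K)
    (f : Mor A B) (f' : Mor A' B') : Mor (dsum A A') (dsum B B') :=
  injl B B' \@ f \@ prjl A A' + injr B B' \@ f' \@ prjr A A'.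

Definition is_cokernel (K : additiveCat) (A B Q : K)
    (f : Mor A B) (q : Mor B Q) : Prop :=
  q \@ f = 0 /\
  forall (X : K) (g : Mor B X), g \@ f = 0 -> exists! h : Mor Q X, h \@ q = g.

Definition weakly_idempotent_complete (K : additiveCat) : Prop :=
  forall (A B : K) (i : Mor A B),
    (exists r : Mor B A, r \@ i = idm A) ->
    exists (Q : K) (q : Mor B Q), is_cokernel i q.

Definition seq_equiv (K : additiveCat) (A B B' C : K)
    (x : Mor A B) (y : Mor B C) (x' : Mor A B') (y' : Mor B' C) : Prop :=
  exists b : Mor B B', [/\ is_iso b, b \@ x = x' & y' \@ b = y].

(* [push a d] is a_* d and [pull c d] is c^* d. *)
Record biadditiveFunctor (K : additiveCat) := BiadditiveFunctor {
  Ext :> K -> K -> zmodType;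
  push : forall C A A' : K, Mor A A' -> Ext C A -> Ext C A';
  pull : forall C C' A : K, Mor C' C -> Ext C A -> Ext C' A;
  push1 : forall (C A : K) (d : Ext C A), push (idm A) d = d;
  pull1 : forall (C A : K) (d : Ext C A), pull (idm C) d = d;
  push_comp : forall (C A A' A'' : K) (a' : Mor A' A'') (a : Mor A A')
    (d : Ext C A), push (a' \@ a) d = push a' (push a d);
  pull_comp : forall (C C' C'' A : K) (c : Mor C' C) (c' : Mor C'' C')
    (d : Ext C A), pull (c \@ c') d = pull c' (pull c d);
  push_pull : forall (C C' A A' : K) (a : Mor A A') (c : Mor C' C)
    (d : Ext C A), push a (pull c d) = pull c (push a d);
  pushD : forall (C A A' : K) (a : Mor A A') (d d' : Ext C A),
    push a (d + d') = push a d + push a d';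
  pullD : forall (C C' A : K) (c : Mor C' C) (d d' : Ext C A),
    pull c (d + d') = pull c d + pull c d';
  push_addm : forall (C A A' : K) (a a' : Mor A A') (d : Ext C A),
    push (a + a') d = push a d + push a' d;
  pull_addm : forall (C C' A : K) (c c' : Mor C' C) (d : Ext C A),
    pull (c + c') d = pull c d + pull c' d
}.

Definition dsum_ext (K : additiveCat) (E : biadditiveFunctor K)
    (C A C' A' : K) (d : E C A) (d' : E C' A') : E (dsum C C') (dsum A A') :=
  push (injl A A') (pull (prjl C C') d) + push (injr A A') (pull (prjr C C') d').

(* [etri x y d] says that the sequence A -x-> B -y-> C belongs to s(d);
   [etri_class] says that s(d) is exactly one equivalence class. *)
Record extriCat := ExtriCat {
  baseCat :> additiveCat;
  EE : biadditiveFunctor baseCat;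
  etri : forall A B C : baseCat, Mor A B -> Mor B C -> EE C A -> Prop;
  etri_class : forall (A C : baseCat) (d : EE C A),
    exists (B : baseCat) (x : Mor A B) (y : Mor B C),
      forall (B' : baseCat) (x' : Mor A B') (y' : Mor B' C),
        etri x' y' d <-> seq_equiv x y x' y';
  etri_realize : forall (A B C A' B' C' : baseCat)
    (x : Mor A B) (y : Mor B C) (d : EE C A)
    (x' : Mor A' B') (y' : Mor B' C') (d' : EE C' A')
    (a : Mor A A') (c : Mor C C'),
    etri x y d -> etri x' y' d' -> push a d = pull c d' ->
    exists b : Mor B B', b \@ x = x' \@ a /\ y' \@ b = c \@ y;
  etri0 : forall A C : baseCat, etri (injl A C) (prjr A C) (0 : EE C A);
  etri_dsum : forall (A B C A' B' C' : baseCat)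
    (x : Mor A B) (y : Mor B C) (d : EE C A)
    (x' : Mor A' B') (y' : Mor B' C') (d' : EE C' A'),
    etri x y d -> etri x' y' d' ->
    etri (dsum_mor x x') (dsum_mor y y') (dsum_ext d d');
  ET3 : forall (A B C A' B' C' : baseCat)
    (x : Mor A B) (y : Mor B C) (d : EE C A)
    (x' : Mor A' B') (y' : Mor B' C') (d' : EE C' A')
    (a : Mor A A') (b : Mor B B'),
    etri x y d -> etri x' y' d' -> b \@ x = x' \@ a ->
    exists c : Mor C C', c \@ y = y' \@ b /\ push a d = pull c d';
  ET3op : forall (A B C A' B' C' : baseCat)
    (x : Mor A B) (y : Mor B C) (d : EE C A)
    (x' : Mor A' B') (y' : Mor B' C') (d' : EE C' A')
    (b : Mor B B') (c : Mor C C'),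
    etri x y d -> etri x' y' d' -> c \@ y = y' \@ b ->
    exists a : Mor A A', b \@ x = x' \@ a /\ push a d = pull c d';
  ET4 : forall (A B C D F : baseCat)
    (f : Mor A B) (f' : Mor B D) (d1 : EE D A)
    (g : Mor B C) (g' : Mor C F) (d2 : EE F B),
    etri f f' d1 -> etri g g' d2 ->
    exists (E : baseCat) (h' : Mor C E) (d : Mor D E) (e : Mor E F)
           (d3 : EE E A),
      [/\ etri (g \@ f) h' d3,
          h' \@ g = d \@ f' /\ e \@ h' = g',
          etri d e (push f' d2),
          pull d d3 = d1 &
          push f d3 = pull e d2];
  ET4op : forall (A B C D F : baseCat)
    (f' : Mor D B) (f : Mor B A) (d1 : EE A D)
    (g' : Mor F C) (g : Mor C B) (d2 : EE B F),
    etri f' f d1 -> etri g' g d2 ->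
    exists (E : baseCat) (h' : Mor E C) (d : Mor E D) (e : Mor F E)
           (d3 : EE A E),
      [/\ etri h' (f \@ g) d3,
          g \@ h' = f' \@ d /\ h' \@ e = g',
          etri e d (pull f' d2),
          push d d3 = d1 &
          pull f d3 = push e d2]
}.

Definition triClass (K : extriCat) :=
  forall A B C : K, Mor A B -> Mor B C -> EE K C A -> Prop.

Record proper_class (K : extriCat) (xi : triClass K) : Prop := ProperClass {
  proper_etri : forall (A B C : K) (x : Mor A B) (y : Mor B C) (d : EE K C A),
    xi A B C x y d -> etri x y d;
  proper_iso : forall (A B C A' B' C' : K)
    (x : Mor A B) (y : Mor B C) (d : EE K C A)
    (x' : Mor A' B') (y' : Mor B' C') (d' : EE K C' A')
    (a : Mor A A') (b : Mor B B') (c : Mor C C'),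
    xi A B C x y d -> etri x' y' d' ->
    is_iso a -> is_iso b -> is_iso c ->
    b \@ x = x' \@ a -> y' \@ b = c \@ y -> push a d = pull c d' ->
    xi A' B' C' x' y' d';
  proper_dsum : forall (A B C A' B' C' : K)
    (x : Mor A B) (y : Mor B C) (d : EE K C A)
    (x' : Mor A' B') (y' : Mor B' C') (d' : EE K C' A'),
    xi A B C x y d -> xi A' B' C' x' y' d' ->
    xi _ _ _ (dsum_mor x x') (dsum_mor y y') (dsum_ext d d');
  (* The empty coproduct is covered here: it is a split E-triangle. *)
  proper_split : forall (A B C : K) (x : Mor A B) (y : Mor B C),
    etri x y (0 : EE K C A) -> xi A B C x y 0;
  proper_base : forall (A B C B' C' : K)
    (x : Mor A B) (y : Mor B C) (d : EE K C A)
    (c : Mor C' C) (x' : Mor A B') (y' : Mor B' C'),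
    xi A B C x y d -> etri x' y' (pull c d) -> xi A B' C' x' y' (pull c d);
  proper_cobase : forall (A B C A' B' : K)
    (x : Mor A B) (y : Mor B C) (d : EE K C A)
    (a : Mor A A') (x' : Mor A' B') (y' : Mor B' C),
    xi A B C x y d -> etri x' y' (push a d) -> xi A' B' C x' y' (push a d);
  proper_saturated : forall (A1 B1 A2 B2 C M : K)
    (x1 : Mor A1 B1) (y1 : Mor B1 C) (d1 : EE K C A1)
    (x2 : Mor A2 B2) (y2 : Mor B2 C) (d2 : EE K C A2)
    (m : Mor A1 M) (n : Mor M B2),
    etri x1 y1 d1 -> xi A2 B2 C x2 y2 d2 -> xi A1 M B2 m n (pull y2 d1) ->
    xi A1 B1 C x1 y1 d1
}.

Definition triClass_sub (K : extriCat) (xi xi' : triClass K) : Prop :=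
  forall (A B C : K) (x : Mor A B) (y : Mor B C) (d : EE K C A),
    xi A B C x y d -> xi' A B C x y d.

Definition xi_inflation_with_cone_in (K : extriCat) (xi : triClass K)
    (X : set K) (A B : K) (x : Mor A B) : Prop :=
  exists (C : K) (y : Mor B C) (d : EE K C A), xi A B C x y d /\ X C.

Definition xi_deflation_with_cocone_in (K : extriCat) (xi : triClass K)
    (X : set K) (B C : K) (y : Mor B C) : Prop :=
  exists (A : K) (x : Mor A B) (d : EE K C A), xi A B C x y d /\ X A.

Definition xi_deflation (K : extriCat) (xi : triClass K)
    (B C : K) (y : Mor B C) : Prop :=
  exists (A : K) (x : Mor A B) (d : EE K C A), xi A B C x y d.

(* The left orthogonal of X with respect to the extensions realized by
   xi-triangles. *)
Definition left_perp (K : extriCat) (xi : triClass K) (X : set K) : set K :=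
  [set Z | forall A : K, X A ->
     forall d : EE K Z A,
       (exists (B : K) (x : Mor A B) (y : Mor B Z), xi A B Z x y d) -> d = 0].

Definition morClass (K : additiveCat) := forall A B : K, set (Mor A B).

Definition is_retract (K : additiveCat) (A B A' B' : K)
    (f : Mor A B) (g : Mor A' B') : Prop :=
  exists (i : Mor A A') (r : Mor A' A) (j : Mor B B') (s : Mor B' B),
    [/\ r \@ i = idm A, s \@ j = idm B, g \@ i = j \@ f & f \@ r = s \@ g].

Definition retract_closed (K : additiveCat) (S : morClass K) : Prop :=
  forall (A B A' B' : K) (f : Mor A B) (g : Mor A' B'),
    is_retract f g -> S A' B' g -> S A B f.

Record modelStructure (K : additiveCat) := ModelStructure {
  CoFib : morClass K;
  Fib : morClass K;
  Weq : morClass K;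
  weq_comp : forall (A B C : K) (f : Mor A B) (g : Mor B C),
    Weq f -> Weq g -> Weq (g \@ f);
  weq_cancell : forall (A B C : K) (f : Mor A B) (g : Mor B C),
    Weq g -> Weq (g \@ f) -> Weq f;
  weq_cancelr : forall (A B C : K) (f : Mor A B) (g : Mor B C),
    Weq f -> Weq (g \@ f) -> Weq g;
  cofib_retract : retract_closed CoFib;
  fib_retract : retract_closed Fib;
  weq_retract : retract_closed Weq;
  model_lift : forall (A B X Y : K) (i : Mor A B) (p : Mor X Y)
    (u : Mor A X) (v : Mor B Y),
    CoFib i -> Fib p -> Weq i \/ Weq p -> p \@ u = v \@ i ->
    exists h : Mor B X, h \@ i = u /\ p \@ h = v;
  model_factor1 : forall (A B : K) (f : Mor A B),
    exists (X : K) (i : Mor A X) (p : Mor X B),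
      [/\ f = p \@ i, CoFib i, Weq i & Fib p];
  model_factor2 : forall (A B : K) (f : Mor A B),
    exists (X : K) (j : Mor A X) (q : Mor X B),
      [/\ f = q \@ j, CoFib j, Fib q & Weq q]
}.

Definition cofibrant (K : additiveCat) (M : modelStructure K) : set K :=
  [set X | CoFib M (0 : Mor (zeroOb K) X)].

Definition fibrant (K : additiveCat) (M : modelStructure K) : set K :=
  [set X | Fib M (0 : Mor X (zeroOb K))].

Definition trivial (K : additiveCat) (M : modelStructure K) : set K :=
  [set X | Weq M (0 : Mor (zeroOb K) X)].

Record admissible (K : extriCat) (xi : triClass K) (M : modelStructure K) :
    Prop := Admissible {
  admissible_cofib : forall (A B : K) (f : Mor A B),
    CoFib M f <-> xi_inflation_with_cone_in xi (cofibrant M) f;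
  admissible_fib : forall (A B : K) (f : Mor A B),
    Fib M f <-> xi_deflation_with_cocone_in xi (fibrant M) f;
  admissible_tcofib : forall (A B : K) (f : Mor A B),
    CoFib M f /\ Weq M f <->
    xi_inflation_with_cone_in xi (cofibrant M `&` trivial M) f;
  admissible_tfib : forall (A B : K) (f : Mor A B),
    Fib M f /\ Weq M f <->
    xi_deflation_with_cocone_in xi (fibrant M `&` trivial M) f
}.

(* Main.v *)
(* M_m and M_1 have the same fibrations, hence the same trivial cofibrations;
   moreover TFib_1 <= TFib_m <= TFib_2, so C_2 <= C_m <= C_1.  By Ken Brown's
   factorization, a weak equivalence between cofibrant objects is a trivial
   cofibration followed by a retraction of another trivial cofibration, so
   between m-cofibrant objects m-weak equivalences are 1-weak equivalences.
   A cofibrant replacement in M_2 of an m-cofibrant object is an m-weak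
   equivalence, because Weq_2 <= Weq_m.  Conversely, if C is 1-cofibrant and
   1-weakly equivalent to an object of C_2, the factorization exhibits C as a
   retract of an m-cofibrant object.

   The extriangulated inputs, used for Weq_2 <= Weq_m, are that an inflation with
   trivial cone is a weak equivalence (via the homotopy pullback of its
   conflation and a cofibrant replacement of the cone) and that a cocone is
   determined by the deflation up to retracts. *)
Require Import Defs.
From mathcomp Require Import all_boot ssralg.
From mathcomp Require Import classical_sets.

Local Open Scope classical_set_scope.

Set Implicit Arguments.
Unset Strict Implicit.

Import GRing.Theory.
Local Open Scope ring_scope.

(** * Additive categories and extensions *)

Section Additive.
Variable K : additiveCat.
Implicit Types A B C : K.

Lemma mcomp0m A B C (f : Mor A B) : (0 : Mor B C) \@ f = 0.
Proof. by apply: (@addIr _ (0 \@ f)); rewrite -mcompDl !add0r. Qed.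

Lemma mcompm0 A B C (g : Mor B C) : g \@ (0 : Mor A B) = 0.
Proof. by apply: (@addIr _ (g \@ 0)); rewrite -mcompDr !add0r. Qed.

Lemma mcompNl A B C (g : Mor B C) (f : Mor A B) : (- g) \@ f = - (g \@ f).
Proof. by apply/eqP; rewrite -addr_eq0 -mcompDl addNr mcomp0m. Qed.

Lemma mcompNr A B C (g : Mor B C) (f : Mor A B) : g \@ (- f) = - (g \@ f).
Proof. by apply/eqP; rewrite -addr_eq0 -mcompDr addNr mcompm0. Qed.

Lemma mor_from_zero A (f : Mor (zeroOb K) A) : f = 0.
Proof. by rewrite -[f]mcompm1 idm_zeroOb mcompm0. Qed.

Lemma dsum_mor_ext A B C (f g : Mor (dsum A B) C) :
  f \@ injl A B = g \@ injl A B -> f \@ injr A B = g \@ injr A B -> f = g.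
Proof.
move=> el er; rewrite -[f]mcompm1 -[g]mcompm1 -dsum_id !mcompDr.
by rewrite !mcompA el er.
Qed.

Lemma copair A B C (f : Mor A C) (g : Mor B C) :
  exists h : Mor (dsum A B) C, h \@ injl A B = f /\ h \@ injr A B = g.
Proof.
exists (f \@ prjl A B + g \@ prjr A B); rewrite !mcompDl -!mcompA.
by rewrite prjl_injl prjr_injl prjl_injr prjr_injr !mcompm0 !mcompm1 addr0 add0r.
Qed.

Variable E : biadditiveFunctor K.

Lemma push0m C A A' (d : E C A) : push (0 : Mor A A') d = 0.
Proof. by apply: (@addIr _ (push 0 d)); rewrite -push_addm !add0r. Qed.

End Additive.

(** * Conflations: uniqueness, cocones and homotopy pullbacks *)

Section Extriangulated.
Variable K : extriCat.
Implicit Types A B C : K.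

Lemma seq_equiv_trans A C B B' B'' (x : Mor A B) (y : Mor B C)
    (x' : Mor A B') (y' : Mor B' C) (x'' : Mor A B'') (y'' : Mor B'' C) :
  seq_equiv x y x' y' -> seq_equiv x' y' x'' y'' -> seq_equiv x y x'' y''.
Proof.
move=> [b [[c [cb bc]] <- yb]] [b' [[c' [cb' bc']] <- yb']].
exists (b' \@ b); split.
- exists (c \@ c'); split.
  + by rewrite mcompA -(mcompA c) cb' mcompm1.
  + by rewrite mcompA -(mcompA b') bc mcompm1.
- by rewrite mcompA.
- by rewrite mcompA yb'.
Qed.

Lemma seq_equiv_sym A C B B' (x : Mor A B) (y : Mor B C)
    (x' : Mor A B') (y' : Mor B' C) :
  seq_equiv x y x' y' -> seq_equiv x' y' x y.
Proof.
move=> [b [[c [cb bc]] <- <-]]; exists c; split.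
- by exists b.
- by rewrite mcompA cb mcomp1m.
- by rewrite -mcompA bc mcompm1.
Qed.

Lemma seq_equiv_refl A B C (x : Mor A B) (y : Mor B C) : seq_equiv x y x y.
Proof.
exists (idm B); rewrite mcomp1m mcompm1; split=> //.
by exists (idm B); rewrite mcomp1m.
Qed.

Lemma etri_exists A C (d : EE K C A) :
  exists (B : K) (x : Mor A B) (y : Mor B C), etri x y d.
Proof.
have [B [x [y cls]]] := etri_class d.
by exists B, x, y; apply/cls; exact: seq_equiv_refl.
Qed.

Lemma etri_unique A C (d : EE K C A) B B' (x : Mor A B) (y : Mor B C)
    (x' : Mor A B') (y' : Mor B' C) :
  etri x y d -> etri x' y' d -> seq_equiv x y x' y'.
Proof.
have [B0 [x0 [y0 cls]]] := etri_class d.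
by move=> /cls /seq_equiv_sym ? /cls; exact: seq_equiv_trans.
Qed.

Lemma etri_equiv A C (d : EE K C A) B B' (x : Mor A B) (y : Mor B C)
    (x' : Mor A B') (y' : Mor B' C) :
  etri x y d -> seq_equiv x y x' y' -> etri x' y' d.
Proof.
have [B0 [x0 [y0 cls]]] := etri_class d.
by move=> /cls e e'; apply/cls; exact: seq_equiv_trans e'.
Qed.

Lemma etri0r A C : etri (injr C A) (prjl C A) (0 : EE K C A).
Proof.
apply: etri_equiv (etri0 A C) _.
exists (injr C A \@ prjl A C + injl C A \@ prjr A C); split.
- exists (injr A C \@ prjl C A + injl A C \@ prjr C A).
  by split; apply: dsum_mor_ext; rewrite !(mcompDl, mcompDr) -!mcompA;
    rewrite ?(prjl_injl, prjr_injr, prjl_injr, prjr_injl, mcompm0, mcompm1,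
              addr0, add0r, mcomp1m).
- by rewrite mcompDl -!mcompA prjl_injl prjr_injl mcompm0 mcompm1 addr0.
- by rewrite mcompDr !mcompA prjl_injl prjl_injr mcomp0m mcomp1m add0r.
Qed.

(** Comparison with the split extension: the induced map of middle terms, followed by the projection
    onto [A'], extends [a] along [x]. *)
Lemma push_eq0_factor A B C A' (x : Mor A B) (y : Mor B C) (d : EE K C A)
    (a : Mor A A') :
  etri x y d -> push a d = 0 -> exists v : Mor B A', v \@ x = a.
Proof.
move=> t ad0; have e : push a d = pull (idm C) 0 by rewrite ad0 pull1.
have [b [bx _]] := etri_realize t (etri0 A' C) e.
by exists (prjl A' C \@ b); rewrite -mcompA bx mcompA prjl_injl mcomp1m.
Qed.

(* The comparison maps compose to [1 + u] with [x u = 0] and [u = v x], so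
   [u^2 = 0] and [1 + u] is invertible. *)
Lemma cocone_retract A A' B C (x : Mor A B) (x' : Mor A' B) (y : Mor B C)
    (d : EE K C A) (d' : EE K C A') :
  etri x y d -> etri x' y d' ->
  exists (i : Mor A A') (r : Mor A' A), r \@ i = idm A.
Proof.
move=> t t'; have e : idm C \@ y = y \@ idm B by rewrite mcomp1m mcompm1.
have [a []] := ET3op t t' e; rewrite mcomp1m pull1 => xa da.
have [a' []] := ET3op t' t e; rewrite mcomp1m pull1 => xa' da'.
pose u := a' \@ a - idm A.
have xu : x \@ u = 0.
  by rewrite mcompDr mcompNr mcompm1 mcompA -xa' -xa subrr.
have du : push u d = 0.
  apply: (@addIr _ (push (idm A) d)).
  by rewrite -push_addm subrK push_comp da da' push1 add0r.
have [v vx] := push_eq0_factor t du.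
have uu : u \@ u = 0 by rewrite -{1}vx -mcompA xu mcompm0.
exists a, ((idm A - u) \@ a').
have -> : (idm A - u) \@ a' \@ a = (idm A - u) \@ (u + idm A).
  by rewrite subrK -mcompA.
rewrite mcompDr mcompm1 mcompDl mcomp1m mcompNl uu oppr0 addr0.
by rewrite addrC subrK.
Qed.

(** Apply (ET4) to the split inclusion [i1] followed by [g]. The class obtained on [E] is recovered
    by applying [p1] to its image under [i1]; pushing along [p2] kills the component [d1] and leaves
    [d2]. *)
Lemma biproduct_pushout A1 A2 S M C (i1 : Mor A1 S) (i2 : Mor A2 S)
    (p1 : Mor S A1) (p2 : Mor S A2) (g : Mor S M) (g' : Mor M C)
    (d1 : EE K C A1) (d2 : EE K C A2) :
  etri i1 p2 0 -> p1 \@ i1 = idm A1 -> p2 \@ i2 = idm A2 ->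
  p1 \@ i2 = 0 -> p2 \@ i1 = 0 ->
  etri g g' (push i1 d1 + push i2 d2) ->
  exists (E : K) (h : Mor M E) (d : Mor A2 E) (e : Mor E C),
    [/\ etri (g \@ i1) h (pull e d1), etri d e d2 & h \@ g = d \@ p2].
Proof.
move=> s pi1 pi2 pi12 pi21 t.
have [E [h [d [e [d3 [t3 [hg _] t2 _ fd3]]]]]] := ET4 s t.
exists E, h, d, e; split=> //.
- have <- // : d3 = pull e d1.
  rewrite -[d3]push1 -pi1 push_comp fd3 push_pull pushD.
  by rewrite -!push_comp pi1 pi12 push1 push0m addr0.
- move: t2; rewrite pushD -!push_comp pi21 pi2 push1 push0m.
  by rewrite add0r.
Qed.

(* The conflation with middle term [M] realizing the extension with components
   [d1] and [d2] is cut along either summand of [A1 (+) A2]. *)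
Lemma homotopy_pullback A1 A2 B1 B2 C (x1 : Mor A1 B1) (y1 : Mor B1 C)
    (d1 : EE K C A1) (x2 : Mor A2 B2) (y2 : Mor B2 C) (d2 : EE K C A2) :
  etri x1 y1 d1 -> etri x2 y2 d2 ->
  exists (M E1 E2 : K) (m1 : Mor A1 M) (m2 : Mor A2 M) (h1 : Mor M E1)
    (h2 : Mor M E2) (e1 : Mor E1 C) (e2 : Mor E2 C)
    (b1 : Mor E1 B1) (b2 : Mor E2 B2),
    [/\ etri m1 h2 (pull e2 d1), etri m2 h1 (pull e1 d2),
        is_iso b1, is_iso b2 & b1 \@ (h1 \@ m1) = x1].
Proof.
move=> t1 t2.
have [M [g [g' t]]] :=
  etri_exists (push (injl A1 A2) d1 + push (injr A1 A2) d2).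
have [E2 [h2 [f2 [e2 [s1 r2 _]]]]] :=
  biproduct_pushout (etri0 A1 A2) (prjl_injl A1 A2) (prjr_injr A1 A2)
    (prjl_injr A1 A2) (prjr_injl A1 A2) t.
(* Exchanging the two components lets the second cut run along [A2], with a quotient that realizes
   [d1]. *)
rewrite addrC in t.
have [E1 [h1 [f1 [e1 [s2 r1 hg1]]]]] :=
  biproduct_pushout (etri0r A2 A1) (prjr_injr A1 A2) (prjl_injl A1 A2)
    (prjr_injl A1 A2) (prjl_injr A1 A2) t.
have [b1 [isob1 bx1 _]] := etri_unique r1 t1.
have [b2 [isob2 _ _]] := etri_unique r2 t2.
exists M, E1, E2, (g \@ injl A1 A2), (g \@ injr A1 A2), h1, h2, e1, e2, b1, b2.
by split=> //; rewrite (mcompA h1) hg1 -mcompA prjl_injl mcompm1.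
Qed.

End Extriangulated.

(** * Model structures *)

Section Model.
Variables (K : additiveCat) (M : modelStructure K).
Implicit Types A B C : K.

Definition llp (P : morClass K) A B (i : Mor A B) : Prop :=
  forall (X Y : K) (p : Mor X Y) (u : Mor A X) (v : Mor B Y),
    P X Y p -> p \@ u = v \@ i -> exists h : Mor B X, h \@ i = u /\ p \@ h = v.

Definition tfib : morClass K := fun A B => [set p | Fib M p /\ Weq M p].

(** The retract argument: lifting [idm B] through [q] gives a section of [q] that carries [i] to
    [j]. *)
Lemma llp_retract (P : morClass K) A B X (i : Mor A B) (j : Mor A X)
    (q : Mor X B) :
  llp P i -> P X B q -> i = q \@ j -> is_retract i j.
Proof.
move=> li Pq e.
have [|h [hi qh]] := li X B q j (idm B) Pq; first by rewrite mcomp1m.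
by exists (idm A), (idm A), h, q; rewrite !mcompm1.
Qed.

(** The converse factors [i] and uses the retract argument. Cofibrations thus depend only on the
    trivial fibrations, which is how two model structures are compared below. *)
Lemma cofib_llp A B (i : Mor A B) : CoFib M i <-> llp tfib i.
Proof.
split=> [ci X Y p u v [fp wp] e | li].
  by apply: (model_lift ci fp _ e); right.
have [X [j [q [e cj fq wq]]]] := model_factor2 M i.
exact: cofib_retract (llp_retract li (conj fq wq) e) cj.
Qed.

Lemma tcofib_llp A B (i : Mor A B) : CoFib M i /\ Weq M i <-> llp (Fib M) i.
Proof.
split=> [[ci wi] X Y p u v fp e | li].
  by apply: (model_lift ci fp _ e); left.
have [X [j [q [e cj wj fq]]]] := model_factor1 M i.
have r := llp_retract li fq e.
by split; [exact: cofib_retract r cj | exact: weq_retract r wj].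
Qed.

Lemma llp_comp (P : morClass K) A B C (i : Mor A B) (j : Mor B C) :
  llp P i -> llp P j -> llp P (j \@ i).
Proof.
move=> li lj X Y p u v Pp; rewrite mcompA => e.
have [h [hi ph]] := li _ _ _ _ _ Pp e.
have [k [kj pk]] := lj _ _ _ _ _ Pp ph.
by exists k; rewrite mcompA kj.
Qed.

(** The inclusion [injl A B] is a cobase change of the map from zero to [B]: a lift on [B] is glued
    to [u] by copairing. *)
Lemma llp_injl (P : morClass K) A B :
  llp P (0 : Mor (zeroOb K) B) -> llp P (injl A B).
Proof.
move=> lB X Y p u v Pp e.
have [|k [_ pk]] := lB X Y p 0 (v \@ injr A B) Pp; first by rewrite !mcompm0.
have [h [hl hr]] := copair u k.
by exists h; split=> //; apply: dsum_mor_ext; rewrite -mcompA ?hl ?hr.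
Qed.

Lemma llp_injr (P : morClass K) A B :
  llp P (0 : Mor (zeroOb K) A) -> llp P (injr A B).
Proof.
move=> lA X Y p u v Pp e.
have [|k [_ pk]] := lA X Y p 0 (v \@ injl A B) Pp; first by rewrite !mcompm0.
have [h [hl hr]] := copair k u.
by exists h; split=> //; apply: dsum_mor_ext; rewrite -mcompA ?hl ?hr.
Qed.

Lemma zero_retract A B (i : Mor A B) (r : Mor B A) :
  r \@ i = idm A -> is_retract (0 : Mor (zeroOb K) A) (0 : Mor (zeroOb K) B).
Proof.
move=> ri; exists (idm _), (idm _), i, r.
by rewrite ri mcomp1m !mcompm0 !mcomp0m.
Qed.

Lemma cofibrant_retract A B (i : Mor A B) (r : Mor B A) :
  r \@ i = idm A -> cofibrant M B -> cofibrant M A.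
Proof. by move=> ri; exact: cofib_retract (zero_retract ri). Qed.

Lemma trivial_retract A B (i : Mor A B) (r : Mor B A) :
  r \@ i = idm A -> trivial M B -> trivial M A.
Proof. by move=> ri; exact: weq_retract (zero_retract ri). Qed.

Lemma cofibrant_codom A B (i : Mor A B) :
  cofibrant M A -> CoFib M i -> cofibrant M B.
Proof.
move=> /cofib_llp lA /cofib_llp li; apply/cofib_llp.
by have := llp_comp lA li; rewrite mcompm0.
Qed.

(** An isomorphism lifts against every morphism, so it is a trivial cofibration. *)
Lemma weq_iso A B (f : Mor A B) : is_iso f -> Weq M f.
Proof.
move=> [g [gf fg]]; suff [] : CoFib M f /\ Weq M f by [].
apply/tcofib_llp => X Y p u v _ e; exists (u \@ g).
by rewrite mcompA e -!mcompA gf fg !mcompm1.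
Qed.

Lemma cofibrant_replacement C :
  exists (D : K) (q : Mor D C), [/\ cofibrant M D, Fib M q & Weq M q].
Proof.
have [D [j [q [_ cj fq wq]]]] := model_factor2 M (0 : Mor (zeroOb K) C).
by exists D, q; split=> //; rewrite [j]mor_from_zero in cj.
Qed.

Lemma trivial_weq A B (f : Mor A B) :
  Weq M f -> trivial M B -> trivial M A.
Proof.
by move=> wf tB; apply: (weq_cancell wf); rewrite mcompm0.
Qed.

(** Factor the copairing of [f] and [idm B] as a cofibration followed by a trivial fibration [q].
    Its restrictions to the summands are cofibrations because the other summand is cofibrant, and
    weak equivalences by two-out-of-three. *)
Lemma ken_brown A B (f : Mor A B) :
  cofibrant M A -> cofibrant M B -> Weq M f ->
  exists (X : K) (j : Mor A X) (s : Mor B X) (q : Mor X B),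
    [/\ CoFib M j /\ Weq M j, CoFib M s /\ Weq M s, q \@ j = f
      & q \@ s = idm B].
Proof.
move=> /cofib_llp lA /cofib_llp lB wf.
have [h [hl hr]] := copair f (idm B).
have [X [k [q [e /cofib_llp lk _ wq]]]] := model_factor2 M h.
have qj : q \@ (k \@ injl A B) = f by rewrite mcompA -e.
have qs : q \@ (k \@ injr A B) = idm B by rewrite mcompA -e.
exists X, (k \@ injl A B), (k \@ injr A B), q; split=> //; split.
- by apply/cofib_llp; apply: llp_comp lk; exact: llp_injl.
- by apply: (weq_cancell wq); rewrite qj.
- by apply/cofib_llp; apply: llp_comp lk; exact: llp_injr.
- apply: (weq_cancell wq); rewrite qs; apply: weq_iso.
  by exists (idm B); rewrite mcomp1m.
Qed.

End Model.

(** * Comparison of model structures through their fibrations *)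

Section Compare.
Variables (K : additiveCat) (M M' : modelStructure K).

Lemma cofibrant_anti :
  (forall A B (p : Mor A B), tfib M p -> tfib M' p) ->
  cofibrant M' `<=` cofibrant M.
Proof.
move=> sub C /cofib_llp lC; apply/cofib_llp => X Y p u v /sub.
exact: lC.
Qed.

Lemma tcofib_anti :
  (forall A B (p : Mor A B), Fib M p -> Fib M' p) ->
  forall A B (i : Mor A B), CoFib M' i /\ Weq M' i -> CoFib M i /\ Weq M i.
Proof.
move=> sub A B i /tcofib_llp li; apply/tcofib_llp => X Y p u v /sub.
exact: li.
Qed.

End Compare.

(** The two trivial cofibrations of the factorization stay trivial cofibrations in [M'], whose
    fibrations are among those of [M]; two-out-of-three does the rest. *)
Lemma weq_between_cofibrant (K : additiveCat) (M M' : modelStructure K) :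
  (forall A B (p : Mor A B), Fib M' p -> Fib M p) ->
  forall A B (f : Mor A B), cofibrant M A -> cofibrant M B ->
  Weq M f -> Weq M' f.
Proof.
move=> sub A B f cA cB wf.
have [X [j [s [q [tj ts <- qs]]]]] := ken_brown cA cB wf.
have [_ wj] := tcofib_anti sub tj; have [_ ws] := tcofib_anti sub ts.
apply: (weq_comp wj); apply: (weq_cancelr ws).
by rewrite qs; apply: weq_iso; exists (idm B); rewrite mcomp1m.
Qed.

(** * Admissible model structures relative to nested proper classes *)

Section Admissible.
Variable K : extriCat.

Lemma fib_mono (xi xi' : triClass K) (M M' : modelStructure K) :
  triClass_sub xi xi' -> admissible xi M -> admissible xi' M' ->
  fibrant M `<=` fibrant M' ->
  forall A B (p : Mor A B), Fib M p -> Fib M' p.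
Proof.
move=> sub ad ad' subF A B p /(admissible_fib ad) [Z [z [d [t FZ]]]].
by apply/(admissible_fib ad'); exists Z, z, d; split; [exact: sub|exact: subF].
Qed.

Lemma tfib_mono (xi xi' : triClass K) (M M' : modelStructure K) :
  triClass_sub xi xi' -> admissible xi M -> admissible xi' M' ->
  fibrant M `&` trivial M `<=` fibrant M' `&` trivial M' ->
  forall A B (p : Mor A B), tfib M p -> tfib M' p.
Proof.
move=> sub ad ad' subF A B p /(admissible_tfib ad) [Z [z [d [t FZ]]]].
by apply/(admissible_tfib ad'); exists Z, z, d; split; [exact: sub|exact: subF].
Qed.

(* The homotopy pullback along a cofibrant replacement [D] of the cone [Z]
   writes [x] as a xi-inflation with cone isomorphic to [D], followed by the
   pulled-back trivial fibration and an isomorphism. *)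
Lemma inflation_trivial_cone_weq (xi : triClass K) (M : modelStructure K)
    (A B Z : K) (x : Mor A B) (y : Mor B Z) (d : EE K Z A) :
  proper_class xi -> admissible xi M -> xi A B Z x y d -> trivial M Z ->
  Weq M x.
Proof.
move=> pr ad t tZ.
have [D [q [cD fq wq]]] := cofibrant_replacement M Z.
have tD := trivial_weq wq tZ.
have [F [k [e [u FWF]]]] := (admissible_tfib ad q).1 (conj fq wq).
have [N [E1 [E2 [m1 [m2 [h1 [h2 [e1 [e2 [b1 [b2 [s1 s2 i1 [c [cb _]] <-]]]]]]]]]]]]
  := homotopy_pullback (proper_etri pr t) (proper_etri pr u).
have [] // : CoFib M m1 /\ Weq M m1.
  apply/(admissible_tcofib ad).
  exists E2, h2, (pull e2 d); split; first exact: (proper_base pr t).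
  by split; [exact: cofibrant_retract cb cD | exact: trivial_retract cb tD].
have [_ wh1] : Fib M h1 /\ Weq M h1.
  apply/(admissible_tfib ad).
  by exists F, m2, (pull e1 e); split=> //; exact: (proper_base pr u).
move=> _ wm1; apply: weq_comp (weq_iso M i1).
exact: weq_comp wm1 wh1.
Qed.

(** The cone of [i] is trivial in [M'] but may fail to be cofibrant there, so only the criterion on
    trivial cones applies. *)
Lemma tcofib_weq_mono (xi xi' : triClass K) (M M' : modelStructure K) :
  proper_class xi' -> triClass_sub xi xi' ->
  admissible xi M -> admissible xi' M' -> trivial M `<=` trivial M' ->
  forall A B (i : Mor A B), CoFib M i -> Weq M i -> Weq M' i.
Proof.
move=> pr sub ad ad' subW A B i ci wi.
have [Z [z [d [t [_ WZ]]]]] := (admissible_tcofib ad i).1 (conj ci wi).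
exact: (inflation_trivial_cone_weq pr ad' (sub _ _ _ _ _ _ t) (subW _ WZ)).
Qed.

(** Admissibility of [M'] provides a trivial cocone of [p], possibly different from the fibrant one
    given by [M]; the latter is a retract of it, hence trivial as well. *)
Lemma fib_weq_reflect (xi xi' : triClass K) (M M' : modelStructure K) :
  proper_class xi -> proper_class xi' -> triClass_sub xi xi' ->
  admissible xi M -> admissible xi' M' ->
  fibrant M `<=` fibrant M' -> trivial M = trivial M' ->
  forall A B (p : Mor A B), Fib M p -> Weq M' p -> Weq M p.
Proof.
move=> pr pr' sub ad ad' subF eqW A B p fp wp.
have fp' := fib_mono sub ad ad' subF fp.
have [Z [z [d [t FZ]]]] := (admissible_fib ad p).1 fp.
have [Z' [z' [d' [t' [_ WZ']]]]] := (admissible_tfib ad' p).1 (conj fp' wp).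
have [i [r ri]] := cocone_retract (proper_etri pr t) (proper_etri pr' t').
suff [] : Fib M p /\ Weq M p by [].
apply/(admissible_tfib ad); exists Z, z, d; split=> //; split=> //.
by rewrite eqW; exact: trivial_retract ri WZ'.
Qed.

(** Factor [f] in [M]: the trivial cofibration is also a weak equivalence of [M'], so
    two-out-of-three there reduces the claim to fibrations. *)
Lemma weq_reflect (xi xi' : triClass K) (M M' : modelStructure K) :
  proper_class xi -> proper_class xi' -> triClass_sub xi xi' ->
  admissible xi M -> admissible xi' M' ->
  fibrant M `<=` fibrant M' -> trivial M = trivial M' ->
  forall A B (f : Mor A B), Weq M' f -> Weq M f.
Proof.
move=> pr pr' sub ad ad' subF eqW A B f wf.
have [X [i [p [e ci wi fp]]]] := model_factor1 M f.
have wi' : Weq M' i.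
  by apply: (tcofib_weq_mono pr' sub ad ad' _ ci wi); rewrite eqW.
have wp' : Weq M' p by apply: (weq_cancelr wi'); rewrite -e.
rewrite e; apply: (weq_comp wi).
exact: (fib_weq_reflect pr pr' sub ad ad' subF eqW fp wp').
Qed.

End Admissible.

(** * Cofibrant objects of the mixed model structure *)

Theorem proposition3p11 (K : extriCat)
    (xi1 xi2 : triClass K) (M1 M2 Mm : modelStructure K) (Cm : set K) :
  weakly_idempotent_complete K ->
  proper_class xi1 -> proper_class xi2 -> triClass_sub xi1 xi2 ->
  admissible xi1 M1 -> admissible xi2 M2 ->
  trivial M1 `<=` trivial M2 -> fibrant M1 `<=` fibrant M2 ->
  Cm = left_perp xi1 (trivial M2 `&` fibrant M1) ->
  admissible xi1 Mm -> cofibrant Mm = Cm ->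
  trivial Mm = trivial M2 -> fibrant Mm = fibrant M1 ->
  (forall C : K,
     Cm C <->
     cofibrant M1 C /\
     exists (C2 : K) (f : Mor C2 C), cofibrant M2 C2 /\ Weq M1 f) /\
  (forall C : K,
     Cm C ->
     exists (C2 : K) (p : Mor C2 C),
       [/\ xi_deflation xi2 p, cofibrant M2 C2 & Weq M1 p]).
Proof.
move=> _ pr1 pr2 sub ad1 ad2 subW subF _ adm <- Wm Fm.
have id1 : triClass_sub xi1 xi1 by move=> ?.
have fib1m A B (p : Mor A B) : Fib M1 p -> Fib Mm p.
  by apply: (fib_mono id1 ad1 adm); rewrite Fm.
have fibm1 A B (p : Mor A B) : Fib Mm p -> Fib M1 p.
  by apply: (fib_mono id1 adm ad1); rewrite Fm.
have Cm1 : cofibrant Mm `<=` cofibrant M1.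
  apply/cofibrant_anti/(tfib_mono id1 ad1 adm); rewrite Fm Wm.
  by move=> ? [? /subW].
have C2m : cofibrant M2 `<=` cofibrant Mm.
  apply/cofibrant_anti/(tfib_mono sub adm ad2); rewrite Fm Wm.
  by move=> ? [/subF].
have replacement C : cofibrant Mm C ->
    exists (C2 : K) (p : Mor C2 C),
      [/\ xi_deflation xi2 p, cofibrant M2 C2 & Weq M1 p].
  move=> cC; have [C2 [p [c2 fp wp]]] := cofibrant_replacement M2 C.
  exists C2, p; split=> //.
    by have [A [x [d [t _]]]] := (admissible_fib ad2 p).1 fp; exists A, x, d.
  (* Both ends of [p] are m-cofibrant, so it suffices that [p] is an m-weak equivalence. *)
  apply: (weq_between_cofibrant fib1m (C2m _ c2) cC).
  by apply: (weq_reflect pr1 pr2 sub adm ad2 _ Wm wp); rewrite Fm.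
split=> // C; split=> [cC | [c1 [C2 [f [c2 wf]]]]].
  split; first exact: Cm1.
  by have [C2 [p [_ c2 wp]]] := replacement C cC; exists C2, p.
have cm2 := C2m _ c2.
(* The object [X] is m-cofibrant, as [j] is also a cofibration of [Mm], and [C] is a retract of [X]
   through [s] and [q]. *)
have [X [j [s [q [tj _ _ qs]]]]] := ken_brown (Cm1 _ cm2) c1 wf.
have [cj _] := tcofib_anti fibm1 tj.
exact: cofibrant_retract qs (cofibrant_codom cm2 cj).
Qed.
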